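(* A set $E$ is finite if and only if there exists an $E$-enumerator.
   Context: A set $E$ is defined to be finite if $\mathcal{P}(E)$ is the only subset $\mathcal{S}$ of the power set $\mathcal{P}(E)$ such that $\varnothing \in \mathcal{S}$ and $F \cup \{e\} \in \mathcal{S}$ whenever $F \in \mathcal{S}$, $F \neq E$ and $e \in E \setminus F$ (this is equivalent to the usual notion of finiteness). For $\mathcal{U} \subset \mathcal{P}(E)$ let $\mathcal{U}^p$ be the set of those elements of $\mathcal{U}$ which are proper subsets of $E$. A subset $\mathcal{U}$ of $\mathcal{P}(E)$ is an $E$-selector if $\varnothing \in \mathcal{U}$ and for each $U \in \mathcal{U}^p$ there exists a unique element $e \in E \setminus U$ such that $U \cup \{e\} \in \mathcal{U}$. If $\mathcal{U}$ is an $E$-selector then a subset $\mathcal{V}$ of $\mathcal{U}$ is invariant if $\varnothing \in \mathcal{V}$ and $V \cup \{e\} \in \mathcal{V}$ for all $V \in \mathcal{V}^p$, where $e$ is the unique element of $E \setminus V$ with $V \cup \{e\} \in \mathcal{U}$. An $E$-selector $\mathcal{U}$ is minimal if the only invariant subset of $\mathcal{U}$ is $\mathcal{U}$ itself. An $E$-enumerator is a minimal $E$-selector which contains $E$ as an element. *)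

(* Defs.v *)
From mathcomp Require Import all_boot boolp classical_sets.

Set Implicit Arguments.
Unset Strict Implicit.
Unset Printing Implicit Defensive.

Local Open Scope classical_set_scope.

(* A set is rendered as a set [E : set T] in an arbitrary ambient type [T];
   taking [E = setT] covers the case of a whole type. *)
Section Enumerators.
Context {T : Type}.
Implicit Types (E F U V : set T) (S UU VV : set (set T)).

Definition subsets E : set (set T) := [set U | U `<=` E].

(* Finiteness by induction on subsets: this is not the library's [finite_set],
   which is defined by a bijection with an initial segment of [nat]. *)
Definition is_finite E : Prop :=
  forall S, S `<=` subsets E ->
    S set0 ->
    (forall F e, S F -> F <> E -> (E `\` F) e -> S (F `|` [set e])) ->
    S = subsets E.

Definition proper_members E UU : set (set T) := [set U | UU U /\ U `<` E].

Definition is_selector E UU : Prop :=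
  [/\ UU `<=` subsets E,
      UU set0 &
      forall U, proper_members E UU U ->
        exists! e, (E `\` U) e /\ UU (U `|` [set e])].

(* When [UU] is an E-selector, the [e] quantified here is unique for each [V],
   so quantifying over all such [e] speaks of that unique element. *)
Definition invariant_subset E UU VV : Prop :=
  [/\ VV `<=` UU,
      VV set0 &
      forall V, proper_members E VV V ->
        forall e, (E `\` V) e -> UU (V `|` [set e]) -> VV (V `|` [set e])].

Definition is_minimal_selector E UU : Prop :=
  is_selector E UU /\ (forall VV, invariant_subset E UU VV -> VV = UU).

Definition is_enumerator E UU : Prop := is_minimal_selector E UU /\ UU E.

End Enumerators.

(* Main.v *)
Require Import Defs.
From mathcomp Require Import all_boot boolp classical_sets.

Local Open Scope classical_set_scope.

(** Both notions are induction principles, and each implication runs one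
    induction inside the other.

    If [E] is finite, the subsets [F] of [E] that have an [F]-enumerator form an
    inductive family: [[set set0]] enumerates the empty set, and an enumerator
    of [F] is prolonged by the single new top element [F `|` [set e]]
    ([enumerator_setU1]). Finiteness puts [E] itself in this family.

    Conversely, minimality of an enumerator [UU] allows induction along the
    chain that climbs from [set0] to [E]. Given an inductive family [S], the
    property that propagates along this chain is not [S U] but the hereditary
    one: every subset of [U] lies in [S] ([hereditary_setU1]). At the top of the
    chain it says that every subset of [E] lies in [S]. *)

(** A subset of [V] together with [e] that contains [e] is obtained by adding
    [e] to a subset of [V]; the latter differs from [E] because it misses [e]. *)
Lemma hereditary_setU1 (T : Type) (E V : set T) (e : T) (S : set (set T)) :
  (forall F x, S F -> F <> E -> (E `\` F) x -> S (F `|` [set x])) ->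
  E e -> subsets V `<=` S -> subsets (V `|` [set e]) `<=` S.
Proof.
move=> addS Ee VS W WVe; have [We|nWe] := pselect (W e); last first.
  by apply: VS => x Wx; case: (WVe x Wx) => // xe; case: nWe; rewrite -xe.
rewrite -(setDUK (A := [set e]) (B := W)); last by move=> x ->.
rewrite setUC; apply: addS.
- by apply: VS => x [Wx xNe]; case: (WVe x Wx).
- by move=> WE; have : (W `\ e) e by [rewrite WE]; case=> _; apply.
- by split=> // -[_]; apply.
Qed.

Lemma enumerator_is_finite (T : Type) (E : set T) (UU : set (set T)) :
  is_enumerator E UU -> is_finite E.
Proof.
move=> [[[UUE UU0 _] minUU] UUtop] S SE S0 addS.
pose VV := [set U | UU U /\ subsets U `<=` S].
have VVUU : VV = UU.
  apply: minUU; split=> [U []//||V [[_ VS] _] e [Ee _] UUVe].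
    by split=> // W; rewrite /subsets /= subset0 => ->.
  by split=> //; exact: (hereditary_setU1 _ _ _ _ _ addS).
have [_ ES] : VV E by rewrite VVUU.
by apply/seteqP.
Qed.

Lemma enumerator_set0 (T : Type) :
  is_enumerator (@set0 T) [set set0].
Proof.
split=> //; split.
  by split=> [U ->//|//|U [-> /properxx]].
by move=> VV [VVsub VV0 _]; apply/seteqP; split=> // U ->.
Qed.

(** The selection rule below [F] is unaffected by the new top element: from a
    member [V] of [UU], adding one point reaches [F `|` [set e]] only when that
    point is [e], since [V] misses [e], and then [V] is [F]. *)
Lemma enumerator_setU1 (T : Type) (F : set T) (e : T) (UU : set (set T)) :
  ~ F e -> is_enumerator F UU ->
  is_enumerator (F `|` [set e]) (UU `|` [set F `|` [set e]]).
Proof.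
move=> nFe [[[UUF UU0 selUU] minUU] UUtop].
have UUNe V : UU V -> ~ V e by move=> /UUF VF /VF.
have memb_proper V : UU V -> V <> F -> proper_members F UU V.
  by move=> UUV VnF; split=> //; rewrite properEneq; split; [apply/eqP|exact: UUF].
have addE V x : UU V -> V `|` [set x] = F `|` [set e] -> x = e /\ V = F.
  move=> UUV VxFe.
  have ex : e = x.
    have : (V `|` [set x]) e by rewrite VxFe; right.
    by case=> // /(UUNe _ UUV).
  rewrite -ex in VxFe *; split=> //; apply/seteqP; split; first exact: UUF.
  move=> y Fy; have : (V `|` [set e]) y by rewrite VxFe; left.
  by case=> // ye; case: nFe; rewrite -ye.
split; last by right.
split; first split.
- by move=> U [/UUF UF|-> //] x /UF; left.
- by left.
- move=> V [[UUV|->] ]; last by move/properxx.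
  move=> _; have [VF|VnF] := pselect (V = F).
    exists e; rewrite VF; split; first by split; [split=> //; right|right].
    by move=> x [[[Fx|->//] nFx] _].
  have [x [[[Fx nVx] UUVx] uniqx]] := selUU V (memb_proper V UUV VnF).
  exists x; split; first by split; [split=> //; left|left].
  move=> y [[Fey nVy] [UUVy|/addE[]//]].
  apply: uniqx; split=> //; split=> //.
  by apply: (UUF _ UUVy); right.
- move=> VV [VVsub VV0 addVV].
  have topP V : V `<=` F -> V `<` F `|` [set e].
    move=> VF; split=> [x /VF|/(_ e)]; first by left.
    by move=> Ve; apply: nFe; apply: VF; apply: Ve; right.
  (* The part of [VV] inside [UU] is invariant, so it is all of [UU]; hence [VV]
     contains [F], from which the rule leads to the new top element. *)
  have UUVV : VV `&` UU = UU.
    apply: minUU; split=> // V [[VVV UUV] _] x [Fx nVx] UUVx; split=> //.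
    apply: addVV => //; last by left.
      by split=> //; apply: topP; apply: UUF.
    by split=> //; left.
  have sUUVV : UU `<=` VV by rewrite -UUVV => U [].
  apply/seteqP; split=> // U [/sUUVV//|->].
  apply: addVV; [|by split=> //; right|by right].
  by split; [apply: sUUVV|apply: topP].
Qed.

Lemma finite_has_enumerator (T : Type) (E : set T) :
  is_finite E -> exists UU, is_enumerator E UU.
Proof.
move=> finE.
pose S := [set F | F `<=` E /\ exists UU, is_enumerator F UU].
have SE : S = subsets E.
  apply: finE => [F []//||F e [FE [UU enumUU]] _ [Ee nFe]].
    by split=> //; exists [set set0]; apply: enumerator_set0.
  split; first by move=> x [/FE|->].
  by exists (UU `|` [set F `|` [set e]]); apply: enumerator_setU1.
by have [] : S E by rewrite SE.
Qed.

Theorem theorem6p1 (T : Type) (E : set T) :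
  is_finite E <-> exists UU : set (set T), is_enumerator E UU.
Proof.
split; first exact: finite_has_enumerator.
by case=> UU; apply: enumerator_is_finite.
Qed.
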